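(* Let $G$ and $H$ be finite simple connected graphs, and let $\circ(G,H)$ be their composition. Then $$M^{ev}(\circ(G,H)) = n(H)^4M^{ev}(G) + n(G)M^{ev}(H) + n(H)^2m(H)M_1(G) + 4n(H)m(G)M_1(H) - 12n(H)m(G)\eta(H).$$
   Context: For a finite simple graph $K$: $V(K)$ and $E(K)$ are its vertex and edge sets, $n(K)=|V(K)|$, $m(K)=|E(K)|$, $d_K(x)$ is the degree of the vertex $x$, $N[x]$ is the closed neighbourhood of $x$, and $\eta(K)$ is the total number of triangles in $K$. For an edge $e=xy$ of $K$, the edge-vertex degree is $deg^{ev}_K(e)=|N[x]\cup N[y]|$; equivalently $deg^{ev}_K(e)=d_K(x)+d_K(y)-\eta_K(e)$, where $\eta_K(e)$ is the number of triangles of $K$ containing $e$. The $ev$-degree Zagreb index is $M^{ev}(K)=\sum_{e\in E(K)} deg^{ev}_K(e)^2$. The first Zagreb index is $M_1(K)=\sum_{x\in V(K)} d_K(x)^2$. The composition $\circ(G,H)$ has vertex set $V(G)\times V(H)$, and $(x,y)$ is adjacent to $(x',y')$ iff either $xx'\in E(G)$, or $x=x'$ and $yy'\in E(H)$. *)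

(* Defs.v *)
From HB Require Import structures.
From mathcomp Require Import all_boot all_order all_algebra.

Set Implicit Arguments.
Unset Strict Implicit.
Unset Printing Implicit Defensive.

Record sgraph := SGraph {
  vertex :> finType;
  adj : rel vertex;
  adj_sym : symmetric adj;
  adj_irrefl : irreflexive adj
}.

Definition edges (K : sgraph) : {set {set K}} :=
  [set e : {set K} | [exists x : K, exists y : K, adj x y && (e == [set x; y])]].

Definition nvert (K : sgraph) : nat := #|K|.

Definition nedge (K : sgraph) : nat := #|edges K|.

Definition degree (K : sgraph) (x : K) : nat := #|[set y : K | adj x y]|.

Definition closed_nbhd (K : sgraph) (x : K) : {set K} :=
  [set y : K | (y == x) || adj x y].

(* The null graph is not connected, per the usual convention. *)
Definition connected_graph (K : sgraph) : Prop :=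
  0 < #|K| /\ forall x y : K, connect (@adj K) x y.

Definition triangles (K : sgraph) : {set {set K}} :=
  [set t : {set K} |
    (#|t| == 3) && [forall x in t, forall y in t, (x != y) ==> adj x y]].

Definition ntriangle (K : sgraph) : nat := #|triangles K|.

(* For an edge e = [set x; y] the union is closed_nbhd x :|: closed_nbhd y. *)
Definition ev_degree (K : sgraph) (e : {set K}) : nat :=
  #|\bigcup_(x in e) closed_nbhd x|.

Definition ev_zagreb (K : sgraph) : nat :=
  \sum_(e in edges K) ev_degree e ^ 2.

Definition first_zagreb (K : sgraph) : nat :=
  \sum_(x : K) degree x ^ 2.

Section Composition.
Variables G H : sgraph.

Definition comp_adj : rel (G * H)%type :=
  fun p q => adj p.1 q.1 || (p.1 == q.1) && adj p.2 q.2.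

Lemma comp_adj_sym : symmetric comp_adj.
Proof.
by move=> p q; rewrite /comp_adj adj_sym eq_sym [adj p.2 _]adj_sym.
Qed.

Lemma comp_adj_irrefl : irreflexive comp_adj.
Proof. by move=> p; rewrite /comp_adj !adj_irrefl andbF. Qed.

Definition composition : sgraph := SGraph comp_adj_sym comp_adj_irrefl.

End Composition.

(* Main.v *)
Require Import Defs.
From mathcomp Require Import all_boot all_order all_algebra.
From mathcomp Require Import ring.

(** An edge of the composition has one of two shapes, and its closed
    neighbourhood can be read off in each case.

    - It projects to an edge [xx'] of [G].  Then [x'] is a neighbour of [x] and
      conversely, so both fibres over [x] and [x'] are covered entirely and the
      neighbourhood is [(N[x] U N[x']) x V(H)].  Each edge of [G] lifts to
      [n(H)^2] such edges, whence the term [n(H)^4 M^ev(G)].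
    - It lies over one vertex [x] and projects to an edge [e] of [H].  Then the
      neighbourhood is the disjoint union of [N(x) x V(H)] and [{x} x N[e]], of
      size [d(x) n(H) + deg^ev(e)].

    Expanding the square in the second case and summing over [x] and [e] gives
    the remaining terms, once the two linear sums are known: the sum of [d(x)]
    is [2 m(G)] (handshake), and the sum of [deg^ev(e)] over the edges of [H] is
    [M_1(H) - 3 eta(H)] ([sum_ev_degree]).  The latter holds because
    [deg^ev(xy)] is [d(x) + d(y)] minus the number of common neighbours, and the
    common neighbours of all edges count every triangle once per vertex.

    Sums over edges are computed as sums over ordered pairs of adjacent
    vertices; the passage is the double count [sum_edge_flags].  All identities
    are kept additive in [nat], the subtraction appearing only at the end. *)

(** * Double counting over edges *)

Lemma edge_in_edges {K : sgraph} (x y : K) :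
  adj x y -> [set x; y] \in edges K.
Proof.
move=> xy; rewrite inE; apply/existsP; exists x; apply/existsP; exists y.
by rewrite xy eqxx.
Qed.

Lemma edgesP {K : sgraph} {e : {set K}} :
  reflect (exists x y : K, adj x y /\ e = [set x; y]) (e \in edges K).
Proof.
apply: (iffP idP) => [|[x [y [xy ->]]]]; last exact: edge_in_edges.
rewrite inE => /existsP[x /existsP[y /andP[xy /eqP ->]]].
by exists x, y.
Qed.

Lemma adj_neq {K : sgraph} (x y : K) : adj x y -> x != y.
Proof. by move=> xy; apply/eqP => eq_xy; rewrite eq_xy adj_irrefl in xy. Qed.

Lemma card_edge {K : sgraph} (e : {set K}) : e \in edges K -> #|e| = 2.
Proof. by case/edgesP => x [y [xy ->]]; rewrite cards2 (adj_neq _ _ xy). Qed.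

Lemma edges_at {K : sgraph} (x : K) :
  [set e in edges K | x \in e] = [set [set x; y] | y in [set y | adj x y]].
Proof.
apply/setP => e; rewrite inE; apply/andP/imsetP => [[]|[y]].
- case/edgesP => u [v [uv ->]]; rewrite !inE => /orP[] /eqP ->.
    by exists v; rewrite ?inE.
  by exists u; rewrite ?inE 1?adj_sym // setUC.
- by rewrite inE => xy ->; rewrite edge_in_edges // !inE eqxx.
Qed.

(** Both sides sum over the incident vertex-edge pairs: an edge through [x] is
    determined by its other endpoint. *)
Lemma sum_edge_flags {K : sgraph} (F : K -> {set K} -> nat) :
  \sum_(e in edges K) \sum_(x in e) F x e =
  \sum_x \sum_(y | adj x y) F x [set x; y].
Proof.
rewrite (exchange_big_dep xpredT) //=; apply: eq_bigr => x _.
transitivity (\sum_(e in [set e in edges K | x \in e]) F x e).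
  by apply: eq_bigl => e; rewrite inE.
rewrite edges_at big_imset /=; first by apply: eq_bigl => y; rewrite inE.
move=> y z; rewrite !inE => xy xz /setP/(_ y).
by rewrite !inE eqxx orbT eq_sym (negPf (adj_neq _ _ xy)) => /esym/eqP.
Qed.

Lemma sum_edges_adj {K : sgraph} (F : {set K} -> nat) :
  2 * \sum_(e in edges K) F e = \sum_x \sum_(y | adj x y) F [set x; y].
Proof.
rewrite -(sum_edge_flags (fun _ => F)) big_distrr /=.
by apply: eq_bigr => e eE; rewrite sum_nat_const card_edge.
Qed.

Lemma degree_sum1 {K : sgraph} (x : K) : \sum_(y | adj x y) 1 = degree x.
Proof. by rewrite sum1dep_card. Qed.

Lemma handshake (K : sgraph) : \sum_(x : K) degree x = 2 * nedge K.
Proof.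
rewrite /nedge -sum1_card sum_edges_adj.
by apply: eq_bigr => x _; rewrite degree_sum1.
Qed.

Lemma sum_edge_degrees (K : sgraph) :
  \sum_(e in edges K) \sum_(x in e) degree x = first_zagreb K.
Proof.
rewrite (sum_edge_flags (fun x _ => degree x)); apply: eq_bigr => x _.
by rewrite sum_nat_cond_const.
Qed.

(** * Triangles and the linear sum of the ev-degrees *)

Definition common_nbhd {K : sgraph} (e : {set K}) : {set K} :=
  [set x | [forall y in e, adj x y]].

(** Removing [x] from a triangle through [x] leaves an edge whose endpoints are
    both adjacent to [x], and conversely. *)
Lemma triangles_at {K : sgraph} (x : K) :
  [set t in triangles K | x \in t] =
  [set x |: e | e in [set e in edges K | x \in common_nbhd e]].
Proof.
apply/setP => t; rewrite inE; apply/andP/imsetP => [[]|[e]].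
- rewrite inE => /andP[/eqP t3 /forall_inP tadj] xt.
  have {}tadj u v : u \in t -> v \in t -> u != v -> adj u v.
    by move=> /tadj /forall_inP ut /ut /implyP; apply.
  have /cards2P[u [v [uv tx]]] : #|t :\ x| == 2.
    by apply/eqP; apply: succn_inj; rewrite -t3 (cardsD1 x t) xt.
  have /setD1P[_ ut] : u \in t :\ x by rewrite tx !inE eqxx.
  have /setD1P[_ vt] : v \in t :\ x by rewrite tx !inE eqxx orbT.
  exists (t :\ x); last by rewrite setD1K.
  rewrite inE {1}tx edge_in_edges ?tadj // inE; apply/forall_inP => w.
  by case/setD1P => wx wt; rewrite tadj // eq_sym.
- rewrite inE => /andP[/edgesP[u [v [uv ->]]]].
  rewrite inE => /forall_inP xadj ->.
  have xu : adj x u by apply: xadj; rewrite !inE eqxx.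
  have xv : adj x v by apply: xadj; rewrite !inE eqxx orbT.
  rewrite setU11 inE cardsU1 cards2 !inE negb_or !adj_neq //=; split=> //.
  apply/forall_inP => a; rewrite !inE => ain.
  apply/forall_inP => b; rewrite !inE => bin; apply/implyP.
  by case/or3P: ain => /eqP ->; case/or3P: bin => /eqP ->;
    rewrite ?eqxx // adj_sym.
Qed.

(** Both sides count the pairs of a triangle and one of its vertices; on the
    left such a pair is recorded as the vertex and the opposite edge. *)
Lemma sum_common_nbhd (K : sgraph) :
  \sum_(e in edges K) #|common_nbhd e| = 3 * ntriangle K.
Proof.
transitivity (\sum_(t in triangles K) \sum_(x in t) 1); last first.
  rewrite mulnC -sum_nat_const; apply: eq_bigr => t.
  by rewrite sum1_card inE => /andP[/eqP].
rewrite (exchange_big_dep xpredT) //=.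
under eq_bigr do rewrite -sum1_card.
rewrite (exchange_big_dep xpredT) //=; apply: eq_bigr => x _.
transitivity #|[set e in edges K | x \in common_nbhd e]|.
  by rewrite -sum1_card; apply: eq_bigl => e; rewrite inE.
transitivity #|[set t in triangles K | x \in t]|; last first.
  by rewrite -sum1_card; apply: eq_bigl => e; rewrite inE.
rewrite triangles_at card_in_imset // => e f.
have notin (g : {set K}) : 
    g \in [set e in edges K | x \in common_nbhd e] -> x \notin g.
  rewrite !inE => /andP[_ /forall_inP adjg].
  by apply/negP => /adjg; rewrite adj_irrefl.
by move=> /notin xe /notin xf ef; rewrite -(setU1K xe) ef setU1K.
Qed.

Lemma ev_degreeE {K : sgraph} (x y : K) :
  ev_degree [set x; y] = #|closed_nbhd x :|: closed_nbhd y|.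
Proof.
rewrite /ev_degree bigcup_setU !big_set1 //.
Qed.

(** The endpoints of an edge are neighbours of each other, so the closed
    neighbourhoods may be replaced by the open ones, and inclusion-exclusion
    applies. *)
Lemma ev_degree_common {K : sgraph} (e : {set K}) : e \in edges K ->
  ev_degree e + #|common_nbhd e| = \sum_(x in e) degree x.
Proof.
case/edgesP => x [y [xy ->]]; rewrite ev_degreeE.
rewrite big_setU1 ?inE ?adj_neq //= big_set1 /degree -[RHS]cardsUI.
congr (_ + _); apply: eq_card => z; rewrite !inE.
  case: (eqVneq z x) => [->|_]; first by rewrite [adj y x]adj_sym xy !orbT.
  by case: (eqVneq z y) => [->|_] //=; rewrite xy.
apply/forall_inP/andP => [az|[xz yz] u].
  by split; rewrite adj_sym; apply: az; rewrite !inE eqxx ?orbT.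
by rewrite !inE => /orP[] /eqP ->; rewrite adj_sym.
Qed.

Lemma sum_ev_degree (K : sgraph) :
  \sum_(e in edges K) ev_degree e + 3 * ntriangle K = first_zagreb K.
Proof.
rewrite -sum_common_nbhd -sum_edge_degrees -big_split /=.
by apply: eq_bigr => e; apply: ev_degree_common.
Qed.

(** * The two kinds of edges of the composition *)

Section Composition.
Variables G H : sgraph.
Local Notation C := (composition G H).

(** The fibres over the two endpoints, where adjacency in [H] could matter, are
    each covered entirely by the neighbourhood of the opposite endpoint. *)
Lemma ev_degree_comp_base (p q : C) : adj p.1 q.1 ->
  ev_degree [set p; q] = nvert H * ev_degree [set p.1; q.1].
Proof.
case: p q => [x y] [x' y'] /= xx'; rewrite !ev_degreeE mulnC.
rewrite /nvert -cardsT -cardsX; apply: eq_card => -[u v].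
rewrite !inE /= /comp_adj /= !xpair_eqE andbT.
case: (eqVneq u x) => [->|nux]; first by rewrite [adj x' x]adj_sym xx' !orbT.
case: (eqVneq u x') => [->|nux']; first by rewrite xx' !orbT.
by rewrite /= !orbF.
Qed.

(** Both endpoints see all the fibres over the neighbours of [x], and adjacency
    in [H] matters only in the fibre over [x] itself. *)
Lemma ev_degree_comp_fibre (x : G) (y y' : H) : adj y y' ->
  ev_degree [set ((x, y) : C); (x, y')] =
  nvert H * degree x + ev_degree [set y; y'].
Proof.
move=> yy'; rewrite !ev_degreeE mulnC.
rewrite /nvert -cardsT -cardsX -[X in _ + X]mul1n -(cards1 x) -cardsX.
rewrite -cardsUI [X in _ + X](_ : _ = 0) ?addn0; last first.
  (* The two parts are disjoint since [x] is not its own neighbour. *)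
  apply/eqP; rewrite cards_eq0; apply/eqP/setP => -[u v]; rewrite !inE /=.
  by case: (eqVneq u x) => [->|]; rewrite ?adj_irrefl ?andbF.
apply: eq_card => -[u v].
rewrite !inE /= /comp_adj /= !xpair_eqE andbT [x == u]eq_sym.
by case: (eqVneq u x) => [->|nux] /=; rewrite ?adj_irrefl ?orbF ?orbb.
Qed.

Lemma sum_comp_base :
  \sum_(p : C) \sum_(q : C | adj p.1 q.1) ev_degree [set p; q] ^ 2 =
  2 * (nvert H ^ 4 * ev_zagreb G).
Proof.
rewrite mulnCA sum_edges_adj big_distrr /=.
transitivity (\sum_(x : G) \sum_(y : H) \sum_(x' : G | adj x x') \sum_(y' : H)
   (nvert H * ev_degree [set x; x']) ^ 2).
  rewrite pair_bigA /=; apply: eq_bigr => -[x y] _ /=.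
  rewrite pair_big /=; apply: eq_big => [[x' y']|[x' y'] xx'] /=.
    by rewrite andbT.
  by rewrite ev_degree_comp_base.
apply: eq_bigr => x _; rewrite sum_nat_const !big_distrr /=.
apply: eq_bigr => x' _; rewrite sum_nat_const -!/(nvert _); ring.
Qed.

Lemma sum_comp_fibre :
  \sum_(p : C) \sum_(q : C | (p.1 == q.1) && adj p.2 q.2)
     ev_degree [set p; q] ^ 2 =
  2 * \sum_(x : G) \sum_(e in edges H) (nvert H * degree x + ev_degree e) ^ 2.
Proof.
rewrite big_distrr /=.
transitivity (\sum_(x : G) \sum_(y : H) \sum_(y' : H | adj y y')
   (nvert H * degree x + ev_degree [set y; y']) ^ 2); last first.
  by apply: eq_bigr => x _; rewrite sum_edges_adj.
rewrite pair_bigA /=; apply: eq_bigr => -[x y] _ /=.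
transitivity (\sum_(x' | x == x') \sum_(y' | adj y y')
   ev_degree [set ((x, y) : C); (x', y')] ^ 2).
  by rewrite pair_big_dep /=; apply: eq_big => [[]|[]].
rewrite (eq_bigl _ _ (fun x' => eq_sym x x')) big_pred1_eq.
by apply: eq_bigr => y' yy'; rewrite ev_degree_comp_fibre.
Qed.

(** The two kinds are exclusive because adjacency in [G] is irreflexive. *)
Lemma ev_zagreb_comp :
  ev_zagreb C = nvert H ^ 4 * ev_zagreb G +
  \sum_(x : G) \sum_(e in edges H) (nvert H * degree x + ev_degree e) ^ 2.
Proof.
apply/eqP; rewrite -(eqn_pmul2l (isT : 0 < 2)) mulnDr; apply/eqP.
rewrite -sum_comp_base -sum_comp_fibre sum_edges_adj -big_split /=.
apply: eq_bigr => p _; rewrite (bigID (fun q : C => adj p.1 q.1)) /=.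
congr (_ + _); apply: eq_bigl => q; rewrite /comp_adj.
  by case: (adj p.1 q.1); rewrite ?andbF.
by case: (eqVneq p.1 q.1) => [->|]; rewrite ?adj_irrefl ?andbT //= orbF andbN.
Qed.

Lemma sum_fibre_squares :
  \sum_(x : G) \sum_(e in edges H) (nvert H * degree x + ev_degree e) ^ 2 =
  nvert H ^ 2 * nedge H * first_zagreb G + nvert G * ev_zagreb H
  + 4 * nvert H * nedge G * \sum_(e in edges H) ev_degree e.
Proof.
set S := \sum_(e in edges H) ev_degree e.
transitivity (\sum_(x : G) (nvert H ^ 2 * nedge H * degree x ^ 2
   + ev_zagreb H + 2 * nvert H * S * degree x)).
  apply: eq_bigr => x _.
  transitivity (\sum_(e in edges H) ((nvert H * degree x) ^ 2
     + ev_degree e ^ 2 + 2 * nvert H * degree x * ev_degree e)).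
    by apply: eq_bigr => e _; ring.
  rewrite !big_split /= sum_nat_const -big_distrr /= -/(nedge H) -/S.
  rewrite -/(ev_zagreb H); ring.
rewrite !big_split /= -!big_distrr /= sum_nat_const handshake.
rewrite -/(first_zagreb G) -/(nvert G); ring.
Qed.

End Composition.

Local Open Scope ring_scope.

Theorem theorem3p3 (G H : sgraph)
    (hG : connected_graph G) (hH : connected_graph H) :
  (ev_zagreb (composition G H))%:Z =
      (nvert H)%:Z ^+ 4 * (ev_zagreb G)%:Z
    + (nvert G)%:Z * (ev_zagreb H)%:Z
    + (nvert H)%:Z ^+ 2 * (nedge H)%:Z * (first_zagreb G)%:Z
    + 4 * (nvert H)%:Z * (nedge G)%:Z * (first_zagreb H)%:Z
    - 12 * (nvert H)%:Z * (nedge G)%:Z * (ntriangle H)%:Z.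
Proof.
rewrite ev_zagreb_comp sum_fibre_squares -(sum_ev_degree H).
ring.
Qed.
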